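(* Let $\gamma>1$, and let $v_-<v_+$ and $\rho_\pm>0$ be real constants. For $\kappa>0$, let $(\rho^\kappa,\rho^\kappa v^\kappa)$ denote the Riemann solution of the isentropic Euler equations with pressure $p(\rho)=\kappa\rho^\gamma$ and initial data $(\rho,v)(x,0)=(\rho_\pm,v_\pm)$ for $\pm x>0$. For some $\kappa>0$, assume that $(\rho^\kappa,\rho^\kappa v^\kappa)$ is a $1$-rarefaction wave and $2$-shock wave solution. Then, when $\kappa\to0$, the solution $(\rho^\kappa,\rho^\kappa v^\kappa)$ tends to the two-contact-discontinuity solution of the pressureless gas system $$\partial_t\rho+\partial_x(\rho v)=0,\qquad \partial_t(\rho v)+\partial_x(\rho v^2)=0$$ with the same Riemann data.
   Context: The isentropic Euler equations are $\partial_t\rho+\partial_x(\rho v)=0$, $\partial_t(\rho v)+\partial_x(\rho v^2+p)=0$, with $p=\kappa\rho^\gamma$, $\kappa>0$, $\gamma>1$. Put $c=\sqrt{p'(\rho)}=\sqrt{\kappa\gamma}\,\rho^{\frac{\gamma-1}{2}}$, $c_\pm=\sqrt{\kappa\gamma}\,\rho_\pm^{\frac{\gamma-1}{2}}$, $\lambda_1=v-c$, $\lambda_2=v+c$. Riemann solution. The Riemann solution is the self-similar entropy solution (a function of $\xi=x/t$). If $v_+-v_-<\frac{2}{\gamma-1}(c_-+c_+)$, it consists of a $1$-wave joining $(\rho_-,v_-)$ on its left to a constant intermediate state $(\rho_*^\kappa,v_*^\kappa)$, $\rho_*^\kappa>0$, followed by a $2$-wave joining $(\rho_*^\kappa,v_*^\kappa)$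 to $(\rho_+,v_+)$ on its right. The intermediate state is the unique pair satisfying one of the $1$-wave relations and one of the $2$-wave relations below (a wave is trivial, i.e. absent, when the two states it joins coincide): $1$-rarefaction: $v_*^\kappa=v_-+\frac{2\sqrt{\kappa\gamma}}{\gamma-1}\big(\rho_-^{\frac{\gamma-1}{2}}-(\rho_*^\kappa)^{\frac{\gamma-1}{2}}\big)$, $\rho_*^\kappa<\rho_-$. $1$-shock: $v_*^\kappa=v_--\sqrt{\frac{\kappa((\rho_*^\kappa)^\gamma-\rho_-^\gamma)}{\rho_*^\kappa\rho_-(\rho_*^\kappa-\rho_-)}}\,(\rho_*^\kappa-\rho_-)$, $\rho_*^\kappa>\rho_-$. $2$-rarefaction: $v_*^\kappa=v_+-\frac{2\sqrt{\kappa\gamma}}{\gamma-1}\big(\rho_+^{\frac{\gamma-1}{2}}-(\rho_*^\kappa)^{\frac{\gamma-1}{2}}\big)$, $\rho_*^\kappa<\rho_+$. $2$-shock: $v_*^\kappa=v_++\sqrt{\frac{\kappa(\rho_+^\gamma-(\rho_*^\kappa)^\gamma)}{\rho_+\rho_*^\kappa(\rho_+-\rho_*^\kappa)}}\,(\rho_*^\kappa-\rho_+)$, $\rho_*^\kappa>\rho_+$. A shock between two states is a jump travelling at the Rankine–Hugoniot speed $[\rho v]/[\rho]$, where $[\cdot]$ is the jump. A $1$-rarefaction is the continuous fan in which $\lambda_1=\xi$ and $v+\frac{2}{\gamma-1}c$ is constant, for $\xi$ between the values of $\lambda_1$ at its two end states; a $2$-rarefaction is the continuous fan in which $\lambda_2=\xi$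 and $v-\frac{2}{\gamma-1}c$ is constant, for $\xi$ between the values of $\lambda_2$ at its two end states. A $1$-rarefaction wave and $2$-shock wave solution is one whose $1$-wave is a $1$-rarefaction and whose $2$-wave is a $2$-shock. If $v_+-v_-\ge\frac{2}{\gamma-1}(c_-+c_+)$, the Riemann solution consists of the state $(\rho_-,v_-)$ for $\xi\le v_--c_-$, the $1$-rarefaction fan ($v-c=\xi$, $v+\frac{2}{\gamma-1}c=v_-+\frac{2}{\gamma-1}c_-$) for $v_--c_-\le\xi\le v_-+\frac{2}{\gamma-1}c_-$, vacuum ($\rho=0$, $\rho v=0$) for $v_-+\frac{2}{\gamma-1}c_-\le\xi\le v_+-\frac{2}{\gamma-1}c_+$, the $2$-rarefaction fan ($v+c=\xi$, $v-\frac{2}{\gamma-1}c=v_+-\frac{2}{\gamma-1}c_+$) for $v_+-\frac{2}{\gamma-1}c_+\le\xi\le v_++c_+$, and the state $(\rho_+,v_+)$ for $\xi\ge v_++c_+$. Two-contact-discontinuity solution. For $v_-<v_+$, the two-contact-discontinuity solution (with a vacuum state) of the pressureless gas system with Riemann data $(\rho_\pm,v_\pm)$ is $$(\rho,\rho v)(x,t)=\begin{cases}(\rho_-,\rho_-v_-), & x<v_-t,\\ (0,0), & v_-t<x<v_+t,\\ (\rho_+,\rho_+v_+), & x>v_+t.\end{cases}$$ *)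

(* Defs.v *)
From HB Require Import structures.
From mathcomp Require Import all_boot all_order all_algebra.
From mathcomp Require Import all_classical all_reals all_analysis.

Set Implicit Arguments.
Unset Strict Implicit.
Unset Printing Implicit Defensive.

Import Order.TTheory GRing.Theory Num.Theory.
Import numFieldNormedType.Exports.

Local Open Scope classical_set_scope.
Local Open Scope ring_scope.

(* A primitive state is a pair (rho, v).  Solutions take values in the
   conserved variables (rho, rho v), so that they make sense in the vacuum,
   where v is undefined. *)
Definition conserved (R : realType) (U : R * R) : R * R := (U.1, U.1 * U.2).

(* c = sqrt (p'(rho)) for p(rho) = kappa rho^gamma *)
Definition sound (R : realType) (gamma kappa rho : R) : R :=
  Num.sqrt (kappa * gamma) * rho `^ ((gamma - 1) / 2).

Definition lambda1 (R : realType) (gamma kappa : R) (U : R * R) : R :=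
  U.2 - sound gamma kappa U.1.

Definition lambda2 (R : realType) (gamma kappa : R) (U : R * R) : R :=
  U.2 + sound gamma kappa U.1.

(* v + 2 c / (gamma - 1) is constant in a 1-rarefaction,
   v - 2 c / (gamma - 1) is constant in a 2-rarefaction *)
Definition invariant1 (R : realType) (gamma kappa : R) (U : R * R) : R :=
  U.2 + 2 / (gamma - 1) * sound gamma kappa U.1.

Definition invariant2 (R : realType) (gamma kappa : R) (U : R * R) : R :=
  U.2 - 2 / (gamma - 1) * sound gamma kappa U.1.

Inductive wave_kind := Trivial | Rarefaction | Shock.

Definition wave1 (R : realType) (gamma kappa : R) (k : wave_kind)
    (UL US : R * R) : Prop :=
  match k with
  | Trivial => US = UL
  | Rarefaction =>
      US.2 = UL.2 + 2 * Num.sqrt (kappa * gamma) / (gamma - 1)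
                    * (UL.1 `^ ((gamma - 1) / 2) - US.1 `^ ((gamma - 1) / 2))
      /\ US.1 < UL.1
  | Shock =>
      US.2 = UL.2 - Num.sqrt (kappa * (US.1 `^ gamma - UL.1 `^ gamma)
                              / (US.1 * UL.1 * (US.1 - UL.1)))
                    * (US.1 - UL.1)
      /\ UL.1 < US.1
  end.

Definition wave2 (R : realType) (gamma kappa : R) (k : wave_kind)
    (US UR : R * R) : Prop :=
  match k with
  | Trivial => US = UR
  | Rarefaction =>
      US.2 = UR.2 - 2 * Num.sqrt (kappa * gamma) / (gamma - 1)
                    * (UR.1 `^ ((gamma - 1) / 2) - US.1 `^ ((gamma - 1) / 2))
      /\ US.1 < UR.1
  | Shock =>
      US.2 = UR.2 + Num.sqrt (kappa * (UR.1 `^ gamma - US.1 `^ gamma)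
                              / (UR.1 * US.1 * (UR.1 - US.1)))
                    * (US.1 - UR.1)
      /\ UR.1 < US.1
  end.

(* Rankine-Hugoniot: [rho v] / [rho] *)
Definition shock_speed (R : realType) (U V : R * R) : R :=
  (V.1 * V.2 - U.1 * U.2) / (V.1 - U.1).

(* Values of xi at the left and right edges of the wave of family i (with
   characteristic speed lambda) joining U to V.  For a trivial wave, U = V and
   both edges are lambda U. *)
Definition left_edge (R : realType) (lambda : R * R -> R) (k : wave_kind)
    (U V : R * R) : R :=
  if k is Shock then shock_speed U V else lambda U.

Definition right_edge (R : realType) (lambda : R * R -> R) (k : wave_kind)
    (U V : R * R) : R :=
  if k is Shock then shock_speed U V else lambda V.

(* w = (rho, rho v) is the value at xi of the 1-fan (resp. 2-fan) on which
   the invariant equals its value at U.  The sign condition is needed because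
   `^ is total.  For xi = lambda1 U (resp. lambda2 U) this forces
   w = conserved U, hence it may also be used for trivial waves. *)
Definition in_fan1 (R : realType) (gamma kappa : R) (U : R * R) (xi : R)
    (w : R * R) : Prop :=
  exists V : R * R, [/\ 0 <= V.1, w = conserved V, lambda1 gamma kappa V = xi
    & invariant1 gamma kappa V = invariant1 gamma kappa U].

Definition in_fan2 (R : realType) (gamma kappa : R) (U : R * R) (xi : R)
    (w : R * R) : Prop :=
  exists V : R * R, [/\ 0 <= V.1, w = conserved V, lambda2 gamma kappa V = xi
    & invariant2 gamma kappa V = invariant2 gamma kappa U].

(* Self-similar profile W(xi) = (rho, rho v)(xi) made of a 1-wave of kind k1
   and a 2-wave of kind k2 separated by a constant state US.  The value of W
   exactly at a shock is left free. *)
Definition two_wave_profile (R : realType) (gamma kappa : R)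
    (k1 k2 : wave_kind) (UL UR : R * R) (W : R -> R * R) : Prop :=
  exists US : R * R,
    [/\ 0 < US.1, wave1 gamma kappa k1 UL US, wave2 gamma kappa k2 US UR
      & let a1 := left_edge (lambda1 gamma kappa) k1 UL US in
        let b1 := right_edge (lambda1 gamma kappa) k1 UL US in
        let a2 := left_edge (lambda2 gamma kappa) k2 US UR in
        let b2 := right_edge (lambda2 gamma kappa) k2 US UR in
        [/\ forall xi, xi < a1 -> W xi = conserved UL,
            k1 <> Shock -> forall xi, a1 <= xi <= b1 ->
              in_fan1 gamma kappa UL xi (W xi),
            forall xi, b1 < xi < a2 -> W xi = conserved US,
            k2 <> Shock -> forall xi, a2 <= xi <= b2 ->
              in_fan2 gamma kappa UR xi (W xi)
          & forall xi, b2 < xi -> W xi = conserved UR]].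

Definition vacuum_profile (R : realType) (gamma kappa : R)
    (UL UR : R * R) (W : R -> R * R) : Prop :=
  let a1 := lambda1 gamma kappa UL in
  let b1 := invariant1 gamma kappa UL in
  let a2 := invariant2 gamma kappa UR in
  let b2 := lambda2 gamma kappa UR in
  [/\ forall xi, xi <= a1 -> W xi = conserved UL,
      forall xi, a1 <= xi <= b1 -> in_fan1 gamma kappa UL xi (W xi),
      forall xi, b1 <= xi <= a2 -> W xi = (0, 0),
      forall xi, a2 <= xi <= b2 -> in_fan2 gamma kappa UR xi (W xi)
    & forall xi, b2 <= xi -> W xi = conserved UR].

Definition no_vacuum (R : realType) (gamma kappa : R) (UL UR : R * R) : Prop :=
  UR.2 - UL.2 < 2 / (gamma - 1) * (sound gamma kappa UL.1
                                   + sound gamma kappa UR.1).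

(* (x, t) |-> W (x / t), t > 0, is the Riemann solution (rho, rho v) of the
   isentropic Euler equations with left state UL and right state UR. *)
Definition riemann_solution (R : realType) (gamma kappa : R)
    (UL UR : R * R) (W : R -> R * R) : Prop :=
  (no_vacuum gamma kappa UL UR ->
     exists k1 k2, two_wave_profile gamma kappa k1 k2 UL UR W)
  /\ (~ no_vacuum gamma kappa UL UR -> vacuum_profile gamma kappa UL UR W).

Definition rarefaction_shock_solution (R : realType) (gamma kappa : R)
    (UL UR : R * R) (W : R -> R * R) : Prop :=
  no_vacuum gamma kappa UL UR
  /\ two_wave_profile gamma kappa Rarefaction Shock UL UR W.

(* The values on the two contact lines x = v t are a convention. *)
Definition two_contact (R : realType) (UL UR : R * R) (x t : R) : R * R :=
  if x < UL.2 * t then conserved UL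
  else if x <= UR.2 * t then (0, 0)
  else conserved UR.

(* Convergence f_kappa -> f in L^1_loc(R x ]0, +oo[) as kappa -> 0+, for
   functions of (x, t); every compact subset of the open half plane is
   contained in such a rectangle. *)
Definition cvg_L1loc (R : realType) (f_ : R -> R -> R -> R) (f : R -> R -> R) :
    Prop :=
  forall a b s T : R, 0 < s ->
    (\int[lebesgue_measure \x lebesgue_measure]_(z in `[a, b] `*` `[s, T])
       (`|f_ kappa z.1 z.2 - f z.1 z.2|)%:E)%E @[kappa --> 0^'+] --> 0%E.

(* Main.v *)
Require Import Defs.
From HB Require Import structures.
From mathcomp Require Import all_boot all_order all_algebra.
From mathcomp Require Import all_classical all_reals all_analysis.
From mathcomp Require Import measurable_realfun ring lra.

(** Since vL < vR and the sound speeds at rhoL and rhoR are of order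
sqrt kappa, the gap vR - vL eventually exceeds 2 / (gamma - 1) times their sum:
for every small kappa the Riemann solution is the one with a vacuum, made of a
1-fan, the vacuum and a 2-fan.  The 1-fan occupies the interval
[vL - cL, vL + 2 / (gamma - 1) cL], which shrinks to the point vL, and likewise
the 2-fan shrinks to vR.  Outside these two intervals the solution is literally
the two-contact solution, and inside them it is bounded uniformly in kappa,
because the sound speed, hence the density, is largest at the outer edge of a
fan.  This is [riemann_solution_close].

Pointwise convergence off the contact lines follows at once: at a fixed
xi = x / t other than vL and vR, the solution is eventually equal to its limit.
For convergence in L^1_loc, note that the set where x / t is within e of vL or
vR and t <= T lies in two strips of width O(e) around the contact lines, so that
its measure in a rectangle is O(e), while the integrand is bounded
([cvg_L1loc_selfsimilar]). *)

Import Order.TTheory GRing.Theory Num.Theory.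
Import numFieldNormedType.Exports.

Local Open Scope classical_set_scope.
Local Open Scope ring_scope.

(** * Self-similar functions that agree off two rays *)

(** The integral of a nonnegative function is a supremum over the simple
functions below it, so it is monotone whether or not the functions are
measurable.  A profile is only known to be close to a step function, which gives
bounds on its values but not its measurability. *)
Lemma le_ge0_integral d (T : measurableType d) (R : realType)
    (mu : {measure set T -> \bar R}) (D : set T) (f g : T -> \bar R) :
  (forall x, D x -> (0 <= f x <= g x)%E) ->
  (\int[mu]_(x in D) f x <= \int[mu]_(x in D) g x)%E.
Proof.
move=> fg.
have f0 x : D x -> (0 <= f x)%E by move=> /fg /andP[].
have g0 x : D x -> (0 <= g x)%E by move=> /fg /andP[]; exact: le_trans.
rewrite !ge0_integralE//; apply: ge_ereal_sup => _ [h hf <-].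
apply: ereal_sup_ubound; exists h => // x; apply: (le_trans (hf x)).
rewrite /patch; case: ifPn => // /set_mem Dx.
by have /andP[] := fg x Dx.
Qed.

Definition strip {R : realType} (v d s T : R) : set (R * R) :=
  [set z | `|z.1 - v * z.2| <= d /\ s <= z.2 <= T].

Lemma measurable_strip (R : realType) (v d s T : R) :
  measurable (strip v d s T).
Proof.
rewrite (_ : strip v d s T =
  (fun z : R * R => `|z.1 - v * z.2|) @^-1` `]-oo, d] `&` snd @^-1` `[s, T]).
  have mf : measurable_fun setT (fun z : R * R => `|z.1 - v * z.2|).
    apply: measurableT_comp => //.
    by apply: measurable_funB => //; apply: measurable_funM.
  apply: measurableI; rewrite -[X in measurable X]setTI; first exact: mf.
  exact: measurable_snd.
by apply/seteqP; split=> z /=; rewrite !in_itv.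
Qed.

(** Every slice at fixed t is an interval of length 2 d, so slicing along x
(the second form of the product measure) makes the bound immediate, even for
v = 0. *)
Lemma strip_measure (R : realType) (v d s T : R) : 0 <= d -> s <= T ->
  ((lebesgue_measure \x lebesgue_measure)%E (strip v d s T)
    <= (2 * d * (T - s))%:E)%E.
Proof.
move=> d0 sT.
rewrite (@product_measure_unique _ _ _ _ _ _ _
  (product_measure2 lebesgue_measure lebesgue_measure)); last 2 first.
- by move=> A B mA mB; exact: product_measure2E.
- exact: measurable_strip.
apply: (@le_trans _ _
  (\int[lebesgue_measure]_(t in `[s, T]) (cst (2 * d)%:E t))%E).
  rewrite integral_mkcond; apply: le_ge0_integral => t _.
  rewrite measure_ge0 /= patchE; case: ifPn => [_|/negP tsT].
    have -> : cst (2 * d)%:E t =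
        lebesgue_measure (`[v * t - d, v * t + d] : set R).
      rewrite lebesgue_measure_itv/= lte_fin -EFinB; case: ifPn => [_|].
        by congr EFin; ring.
      by rewrite -leNgt => h; congr EFin; lra.
    apply: le_measure; rewrite ?inE //.
      exact: (measurable_ysection _ (measurable_strip _ _ _ _ _)).
    move=> x /ysectionP[/= + _]; rewrite in_itv/= ler_norml.
    by move=> /andP[h1 h2]; apply/andP; split; lra.
  rewrite [X in lebesgue_measure X](_ : _ = set0) ?measure0//.
  by apply/seteqP; split=> // x /ysectionP[_ h]; apply: tsT; rewrite inE.
rewrite integral_cst//.
have muE : lebesgue_measure (`[s, T] : set R) = (T - s)%:E.
  rewrite lebesgue_measure_itv/= lte_fin -EFinB; case: ifPn => //.
  by rewrite -leNgt => h; congr EFin; lra.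
by rewrite [X in (_ * X)%E](_ : _ = (T - s)%:E) ?muE// -EFinM.
Qed.

Lemma ge0_cvge0 (R : realType) (I : Type) (F : set_system I) {FF : Filter F}
    (f : I -> \bar R) :
  (forall e : R, 0 < e -> \forall k \near F, (0 <= f k <= e%:E)%E) ->
  f @ F --> 0%E.
Proof.
move=> fe; apply/fine_cvgP; split.
  near=> k; have /andP[f0 f1] : (0 <= f k <= 1%:E)%E by near: k; exact: fe.
  by rewrite ge0_fin_numE// (le_lt_trans f1) ?ltry.
apply/cvgr0Pnorm_le => e e0; near=> k.
have : (0 <= f k <= e%:E)%E by near: k; exact: fe.
move=> /=; case: (f k) => [r| |] /=; rewrite ?lee_fin ?normr0 ?(ltW e0)//.
by move=> /andP[r0 re]; rewrite ger0_norm.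
Unshelve. all: by end_near. Qed.

(** If |x / t - v| <= e and t <= T then |x - v t| <= e T: on the rectangle the
integrand is at most M, and vanishes outside two strips of half-width e T, whose
total measure is at most 4 e T (T - s). *)
Lemma cvg_L1loc_selfsimilar (R : realType) (v1 v2 M : R) (w_ : R -> R -> R)
    (w : R -> R) (f : R -> R -> R) :
  (forall x t, 0 < t -> f x t = w (x / t)) -> 0 <= M ->
  (forall e, 0 < e -> \forall k \near 0^'+, forall xi,
     (e < `|xi - v1| -> e < `|xi - v2| -> w_ k xi = w xi)
     /\ `|w_ k xi - w xi| <= M) ->
  cvg_L1loc (fun k x t => w_ k (x / t)) f.
Proof.
move=> fw M0 close a b s T s0; apply: ge0_cvge0 => eps eps0.
have [sT|Ts] := leP s T; last first.
  near=> k; rewrite (_ : `[a, b] `*` `[s, T] = set0).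
    by rewrite integral_set0 lexx lee_fin ltW.
  apply/seteqP; split=> // -[x t] [_] /=; rewrite in_itv/= => /andP[h1 h2].
  by have := le_lt_trans (le_trans h1 h2) Ts; rewrite ltxx.
pose K := M * (4 * T * (T - s)).
have T0 : 0 < T by exact: lt_le_trans sT.
have K0 : 0 <= K by rewrite /K !mulr_ge0// ?subr_ge0// ltW.
(* The integral will be at most e * K; the + 1 covers K = 0. *)
pose e := eps / (K + 1).
have e0 : 0 < e by rewrite divr_gt0// ltr_wpDl.
have eK : e * K <= eps.
  rewrite /e mulrAC ler_pdivrMr ?ltr_wpDl//.
  by rewrite ler_pM2l// lerDl.
near=> k.
have closek : forall xi,
    (e < `|xi - v1| -> e < `|xi - v2| -> w_ k xi = w xi)
     /\ `|w_ k xi - w xi| <= M by near: k; exact: close.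
pose D : set (R * R) := `[a, b] `*` `[s, T].
have mD : measurable D by exact: measurableX.
pose S := strip v1 (e * T) s T `|` strip v2 (e * T) s T.
have mS : measurable S by apply: measurableU; exact: measurable_strip.
apply/andP; split; first by apply: integral_ge0 => z _; rewrite lee_fin.
apply: (@le_trans _ _ (\int[lebesgue_measure \x lebesgue_measure]_(z in D)
  (M%:E * (\1_S z)%:E))%E).
  apply: le_ge0_integral => -[x t] [/= _]; rewrite in_itv/= => /andP[st tT].
  have t0 : 0 < t by exact: lt_le_trans st.
  rewrite lee_fin normr_ge0/= -EFinM lee_fin fw//.
  have strip_near v : `|x / t - v| <= e -> strip v (e * T) s T (x, t).
    move=> h; split=> /=; last by rewrite st.
    have -> : x - v * t = (x / t - v) * t by rewrite mulrBl divfK ?gt_eqF.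
    by rewrite normrM (gtr0_norm t0) ler_pM// ltW.
  have [out bnd] := closek (x / t).
  rewrite indicE; have [|zS] := boolP (_ \in S); first by rewrite mulr1.
  rewrite out ?subrr ?normr0 ?mulr0// ltNge; apply/negP => /strip_near h;
    move/negP: zS; apply; rewrite inE; [by left|by right].
rewrite ge0_integralZl_EFin//; last first.
  by apply/measurable_EFinP; exact: measurable_indic.
rewrite integral_indic//.
apply: (@le_trans _ _ (M%:E * (e * (4 * T * (T - s)))%:E)%E).
  apply: lee_wpmul2l; first by rewrite lee_fin.
  apply: (@le_trans _ _ ((lebesgue_measure \x lebesgue_measure)%E S)).
    by apply: le_measure; rewrite ?inE//; exact: measurableI.
  rewrite /S; apply: le_trans.
    by apply: measureU2; exact: measurable_strip.
  have eT0 : 0 <= e * T by rewrite mulr_ge0// ltW.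
  apply: (le_trans (leeD (strip_measure _ v1 _ _ _ eT0 sT)
    (strip_measure _ v2 _ _ _ eT0 sT))).
  by rewrite -EFinD lee_fin le_eqVlt; apply/orP; left; apply/eqP; ring.
rewrite -EFinM lee_fin (le_trans _ eK)// le_eqVlt; apply/orP; left.
by apply/eqP; rewrite /K; ring.
Unshelve. all: by end_near. Qed.

(** * The vacuum solution near its limit *)

Lemma sound_ge0 (R : realType) (gamma kappa rho : R) :
  0 <= sound gamma kappa rho.
Proof. by rewrite mulr_ge0 ?sqrtr_ge0 ?powR_ge0. Qed.

Lemma sound_le (R : realType) (gamma kappa r1 r2 : R) :
  1 < gamma -> 0 < kappa -> 0 <= r1 -> 0 <= r2 ->
  sound gamma kappa r1 <= sound gamma kappa r2 -> r1 <= r2.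
Proof.
move=> g1 k0 r10 r20.
have g0 : 0 < gamma by lra.
rewrite /sound ler_pM2l ?sqrtr_gt0 ?mulr_gt0// => h.
rewrite leNgt; apply/negP => r21; move: h; apply/negP; rewrite -ltNge.
by apply: gt0_ltr_powR; rewrite ?nnegrE//; lra.
Qed.

Lemma sound_cvg0 (R : realType) (gamma rho : R) :
  sound gamma kappa rho @[kappa --> 0^'+] --> (0 : R).
Proof.
have := continuous_comp (@mulrr_continuous R gamma 0)
  (@sqrt_continuous R (0 * gamma)).
rewrite /prop_for /continuous_at /= mul0r sqrtr0.
move=> /cvg_at_right_filter sqrt_cvg0.
rewrite -[X in _ --> X](mul0r (rho `^ ((gamma - 1) / 2))).
by apply: cvgM => //; exact: cvg_cst.
Qed.

Lemma norm_conserved_le (R : realType) (rho v d : R) (V : R * R) :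
  0 <= V.1 <= rho -> `|V.2 - v| <= d ->
  `|conserved V| <= rho * (1 + `|v| + d).
Proof.
move=> /andP[V0 Vrho] Vd.
have V2 : `|V.2| <= `|v| + d.
  by rewrite -[V.2](subrK v) addrC (le_trans (ler_normD _ _))// lerD2l.
have rho0 : 0 <= rho by exact: le_trans Vrho.
have d0 : 0 <= d by exact: le_trans Vd.
rewrite prod_normE /= ge_max normrM (ger0_norm V0); apply/andP; split.
  by rewrite (le_trans Vrho)// ler_peMr// -addrA lerDl addr_ge0.
by apply: ler_pM => //; apply: le_trans V2 _; lra.
Qed.

(** Write c for the sound speed, A = 2 / (gamma - 1), and index 0 for the state
(rho, v).  On the fan v' - c' = xi and v' + A c' = v + A c0, so that
(1 + A) c' = v + A c0 - xi <= (1 + A) c0 as soon as xi >= v - c0.  Hence c', and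
with it the density, is largest at the outer edge, and v' stays within
(1 + A) c0 of v. *)
Lemma in_fan1_le (R : realType) (gamma kappa rho v xi d : R) (w : R * R) :
  1 < gamma -> 0 < kappa -> 0 < rho ->
  (1 + 2 / (gamma - 1)) * sound gamma kappa rho <= d ->
  lambda1 gamma kappa (rho, v) <= xi -> in_fan1 gamma kappa (rho, v) xi w ->
  `|w| <= rho * (1 + `|v| + d).
Proof.
move=> g1 k0 rho0 + + [V [V0 -> ]].
rewrite /lambda1 /invariant1 /=.
have A0 : 0 < 2 / (gamma - 1) by apply: divr_gt0; lra.
have := @sound_le R gamma kappa V.1 rho g1 k0 V0 (ltW rho0).
have := sound_ge0 R gamma kappa V.1.
have := sound_ge0 R gamma kappa rho.
move: (sound _ _ _) (sound _ _ V.1) (2 / _) A0.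
move=> c cV A A0 c0 cV0 cle cd xi0 xiE inv.
have cVc : cV <= c.
  rewrite -(ler_pM2l (_ : 0 < 1 + A)); last lra.
  by rewrite !mulrDl; lra.
apply: norm_conserved_le; first by rewrite V0 cle.
have AcV : 0 <= A * cV by rewrite mulr_ge0// ltW.
by rewrite mulrDl in cd; rewrite ler_norml; apply/andP; split; nra.
Qed.

(** The reflection x -> - x, v -> - v exchanges the two families of waves. *)
Lemma in_fan2_reflect (R : realType) (gamma kappa rho v xi : R) (w : R * R) :
  in_fan2 gamma kappa (rho, v) xi w ->
  in_fan1 gamma kappa (rho, - v) (- xi) (w.1, - w.2).
Proof.
move=> [V [V0 -> ]]; rewrite /lambda2 /invariant2 /= => xiE inv.
exists (V.1, - V.2); split=> //=; first by rewrite /conserved/= mulrN.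
  by rewrite /lambda1/=; lra.
by rewrite /invariant1/=; lra.
Qed.

Lemma in_fan2_le (R : realType) (gamma kappa rho v xi d : R) (w : R * R) :
  1 < gamma -> 0 < kappa -> 0 < rho ->
  (1 + 2 / (gamma - 1)) * sound gamma kappa rho <= d ->
  xi <= lambda2 gamma kappa (rho, v) -> in_fan2 gamma kappa (rho, v) xi w ->
  `|w| <= rho * (1 + `|v| + d).
Proof.
move=> g1 k0 rho0 hd xi_le /in_fan2_reflect w_fan.
have -> : `|w| = `|(w.1, - w.2)| by rewrite !prod_normE/= normrN.
rewrite -(normrN v); apply: in_fan1_le w_fan => //.
by move: xi_le; rewrite /lambda1 /lambda2/=; lra.
Qed.

(** The number d bounds the widths (1 + A) cL and (1 + A) cR of the two fans, so
a xi further than d from vL and vR meets neither of them. *)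
Lemma vacuum_profile_close (R : realType)
    (gamma kappa rhoL vL rhoR vR d : R) (W : R -> R * R) :
  1 < gamma -> 0 < kappa -> 0 < rhoL -> 0 < rhoR ->
  (1 + 2 / (gamma - 1)) * (sound gamma kappa rhoL + sound gamma kappa rhoR)
    <= d ->
  vacuum_profile gamma kappa (rhoL, vL) (rhoR, vR) W ->
  forall xi,
    (d < `|xi - vL| -> d < `|xi - vR| ->
      W xi = two_contact (rhoL, vL) (rhoR, vR) xi 1)
    /\ `|W xi| <= (rhoL + rhoR) * (1 + `|vL| + `|vR| + d).
Proof.
move=> g1 k0 rhoL0 rhoR0 hd [].
have fL := @in_fan1_le R gamma kappa rhoL vL _ d _ g1 k0 rhoL0.
have fR := @in_fan2_le R gamma kappa rhoR vR _ d _ g1 k0 rhoR0.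
move: fL fR hd; rewrite /lambda1 /lambda2 /invariant1 /invariant2 /=.
have A0 : 0 < 2 / (gamma - 1) by apply: divr_gt0; lra.
have := sound_ge0 R gamma kappa rhoL.
have := sound_ge0 R gamma kappa rhoR.
move: (sound _ _ rhoL) (sound _ _ rhoR) (2 / _) A0.
move=> cL cR A A0 cR0 cL0 fL fR hd far_left fan_left vac fan_right far_right xi.
have AL : 0 <= A * cL by rewrite mulr_ge0// ltW.
have AR : 0 <= A * cR by rewrite mulr_ge0// ltW.
rewrite mulrDl mulrDr mul1r in hd.
have {}fL w : vL - cL <= xi -> in_fan1 gamma kappa (rhoL, vL) xi w ->
  `|w| <= rhoL * (1 + `|vL| + d) by apply: fL; lra.
have {}fR w : xi <= vR + cR -> in_fan2 gamma kappa (rhoR, vR) xi w ->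
  `|w| <= rhoR * (1 + `|vR| + d) by apply: fR; lra.
have d0 : 0 <= d by lra.
have nL := normr_ge0 vL.
have nR := normr_ge0 vR.
have boundL x : x <= rhoL * (1 + `|vL| + d) ->
  x <= (rhoL + rhoR) * (1 + `|vL| + `|vR| + d).
  by move=> /le_trans; apply; apply: ler_pM; lra.
have boundR x : x <= rhoR * (1 + `|vR| + d) ->
  x <= (rhoL + rhoR) * (1 + `|vL| + `|vR| + d).
  by move=> /le_trans; apply; apply: ler_pM; lra.
split.
  rewrite /two_contact !mulr1 => dL dR.
  have [xL|Lx|xL] := ltgtP xi vL.
  - apply: far_left; move: dL; rewrite ltr0_norm; lra.
  - rewrite gtr0_norm in dL; last lra.
    have [xR|Rx] := leP xi vR.
      apply: vac; move: dR; rewrite ler0_norm; last lra.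
      by move=> dR; apply/andP; split; lra.
    apply: far_right; move: dR; rewrite gtr0_norm; lra.
  - by move: dL; rewrite xL subrr normr0 ltNge d0.
have [x1|x1] := leP xi (vL - cL).
  rewrite far_left//; apply/boundL/norm_conserved_le => /=; last first.
    by rewrite subrr normr0.
  by rewrite lexx ltW.
have [x2|x2] := leP xi (vL + A * cL).
  by apply/boundL/fL; [exact: ltW|apply: fan_left; rewrite x2 ltW].
have [x3|x3] := leP xi (vR - A * cR).
  rewrite vac; last by rewrite x3 ltW.
  rewrite prod_normE/= normr0 maxxx.
  by apply: mulr_ge0; lra.
have [x4|x4] := leP xi (vR + cR).
  by apply/boundR/fR => //; apply: fan_right; rewrite x4 ltW.
rewrite far_right; last exact: ltW.
apply/boundR/norm_conserved_le => /=; last first.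
  by rewrite subrr normr0.
by rewrite lexx ltW.
Qed.

Lemma riemann_solution_close (R : realType) (gamma rhoL vL rhoR vR : R)
    (W : R -> R -> R * R) :
  1 < gamma -> vL < vR -> 0 < rhoL -> 0 < rhoR ->
  (forall kappa : R, 0 < kappa ->
     riemann_solution gamma kappa (rhoL, vL) (rhoR, vR) (W kappa)) ->
  forall e : R, 0 < e -> \forall kappa \near 0^'+, forall xi,
    (e < `|xi - vL| -> e < `|xi - vR| ->
      W kappa xi = two_contact (rhoL, vL) (rhoR, vR) xi 1)
    /\ `|W kappa xi| <= (rhoL + rhoR) * (2 + `|vL| + `|vR|).
Proof.
move=> g1 vLR rhoL0 rhoR0 hW e e0.
have A0 : 0 < 2 / (gamma - 1) by apply: divr_gt0; lra.
(* Fans no wider than d lie within e of vL and vR, leave room for a vacuum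
   (d <= vR - vL), and satisfy a bound without d (d <= 1). *)
pose d := Num.min e (Num.min 1 (vR - vL)).
have [d0 de d1 dv] : [/\ 0 < d, d <= e, d <= 1 & d <= vR - vL].
  by split; rewrite /d ?lt_min ?ge_min ?e0 ?ltr01 ?subr_gt0 ?lexx ?orbT.
have width0 : (1 + 2 / (gamma - 1)) * (sound gamma kappa rhoL
    + sound gamma kappa rhoR) @[kappa --> 0^'+] --> (0 : R).
  rewrite [X in _ --> X](_ : 0 = (1 + 2 / (gamma - 1)) * (0 + 0)).
    by apply: cvgM; [exact: cvg_cst|apply: cvgD; exact: sound_cvg0].
  by rewrite addr0 mulr0.
near=> kappa.
have k0 : 0 < kappa by near: kappa; exact: nbhs_right_gt.
have width : (1 + 2 / (gamma - 1)) *
    (sound gamma kappa rhoL + sound gamma kappa rhoR) <= d.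
  apply: le_trans (ler_norm _) _; near: kappa.
  by move/cvgr0Pnorm_le : width0; apply.
have vacuum : ~ no_vacuum gamma kappa (rhoL, vL) (rhoR, vR).
  rewrite /no_vacuum/=; apply/negP; rewrite -leNgt.
  apply: le_trans dv; apply: le_trans width.
  by rewrite ler_wpM2r ?addr_ge0 ?sound_ge0 ?lerDr.
have close := @vacuum_profile_close R _ _ _ _ _ _ _ _ g1 k0 rhoL0 rhoR0 width
  ((hW kappa k0).2 vacuum).
move=> xi; have [out bnd] := close xi; split.
  by move=> eL eR; apply: out; exact: le_lt_trans de _.
apply: le_trans bnd _; rewrite ler_pM2l ?addr_gt0//; lra.
Unshelve. all: by end_near. Qed.

(** * Convergence to the two-contact solution *)

Lemma norm_fst_le (R : realDomainType) (U V : normedZmodType R) (x : U * V) :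
  `|x.1| <= `|x|.
Proof. by rewrite prod_normE le_max lexx. Qed.

Lemma norm_snd_le (R : realDomainType) (U V : normedZmodType R) (x : U * V) :
  `|x.2| <= `|x|.
Proof. by rewrite prod_normE le_max lexx orbT. Qed.

Lemma two_contact_selfsimilar (R : realType) (UL UR : R * R) (x t : R) :
  0 < t -> two_contact UL UR x t = two_contact UL UR (x / t) 1.
Proof.
by move=> t0; rewrite /two_contact !mulr1 ltr_pdivrMr// ler_pdivrMr.
Qed.

Theorem theorem4p2 (R : realType) (gamma rhoL vL rhoR vR : R)
    (W : R -> R -> R * R)
    (hgamma : 1 < gamma) (hv : vL < vR) (hrhoL : 0 < rhoL) (hrhoR : 0 < rhoR)
    (hW : forall kappa : R, 0 < kappa ->
       riemann_solution gamma kappa (rhoL, vL) (rhoR, vR) (W kappa))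
    (hRS : exists2 kappa : R, 0 < kappa &
       rarefaction_shock_solution gamma kappa (rhoL, vL) (rhoR, vR) (W kappa)) :
  (forall x t : R, 0 < t -> x <> vL * t -> x <> vR * t ->
     W kappa (x / t) @[kappa --> 0^'+]
       --> two_contact (rhoL, vL) (rhoR, vR) x t)
  /\ cvg_L1loc (fun kappa x t => (W kappa (x / t)).1)
       (fun x t => (two_contact (rhoL, vL) (rhoR, vR) x t).1)
  /\ cvg_L1loc (fun kappa x t => (W kappa (x / t)).2)
       (fun x t => (two_contact (rhoL, vL) (rhoR, vR) x t).2).
Proof.
have close := @riemann_solution_close R gamma rhoL vL rhoR vR W hgamma hv
  hrhoL hrhoR hW.
split.
  move=> x t t0 xL xR; apply: cvg_near_cst.
  have dist0 v : x <> v * t -> 0 < `|x / t - v|.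
    move=> xv; rewrite normr_gt0 subr_eq0; apply/eqP => h; apply: xv.
    by rewrite -h divfK ?gt_eqF.
  pose m : R := Num.min `|x / t - vL| `|x / t - vR|.
  have m0 : 0 < m by rewrite lt_min !dist0.
  have mL : m <= `|x / t - vL| by rewrite ge_min lexx.
  have mR : m <= `|x / t - vR| by rewrite ge_min lexx orbT.
  have /close : 0 < m / 2 by lra.
  apply: filterS => kappa /(_ (x / t))[out _].
  by rewrite two_contact_selfsimilar// out//; lra.
pose B := (rhoL + rhoR) * (2 + `|vL| + `|vR|).
have w_le xi : `|two_contact (rhoL, vL) (rhoR, vR) xi 1| <= B.
  have nL := normr_ge0 vL.
  have nR := normr_ge0 vR.
  have conserved_le rho v : 0 < rho -> rho <= rhoL + rhoR ->
      `|v| <= `|vL| + `|vR| -> `|conserved (rho, v)| <= B.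
    move=> rho0 rhole vle.
    apply: le_trans (norm_conserved_le R rho v 0 (rho, v) _ _) _ => /=.
    - by rewrite lexx ltW.
    - by rewrite subrr normr0.
    - by have nv := normr_ge0 v; apply: ler_pM; lra.
  rewrite /two_contact; case: ifP => _; first by apply: conserved_le; lra.
  case: ifP => _; last by apply: conserved_le; lra.
  by rewrite prod_normE/= normr0 maxxx /B mulr_ge0//; lra.
have B0 : 0 <= B by exact: le_trans (w_le 0).
have diff_le kappa xi : `|W kappa xi| <= B ->
    `|W kappa xi - two_contact (rhoL, vL) (rhoR, vR) xi 1| <= 2 * B.
  by move=> h; apply: le_trans (ler_normB _ _) _; have := w_le xi; lra.
have twoB0 : 0 <= 2 * B by lra.
have cvg_proj (p : R * R -> R) : (forall U V, `|p U - p V| <= `|U - V|) ->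
    cvg_L1loc (fun kappa x t => p (W kappa (x / t)))
      (fun x t => p (two_contact (rhoL, vL) (rhoR, vR) x t)).
  move=> p_lip; apply: (@cvg_L1loc_selfsimilar R vL vR (2 * B)
    (fun kappa xi => p (W kappa xi))
    (fun xi => p (two_contact (rhoL, vL) (rhoR, vR) xi 1))) => //.
    by move=> x t t0; rewrite two_contact_selfsimilar.
  move=> e e0; apply: filterS (close e e0) => kappa h xi.
  have [out bnd] := h xi; split; first by move=> eL eR; rewrite out.
  exact: le_trans (p_lip _ _) (diff_le _ _ bnd).
split; apply: cvg_proj => U V.
  exact: (norm_fst_le _ _ _ (U - V)).
exact: (norm_snd_le _ _ _ (U - V)).
Qed.
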